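(* Let $R$ be a commutative ring with identity. The following are equivalent: (1) Every Gorenstein projective $R$-module is strongly Gorenstein projective. (2) For every $R$-module $M$ with $\mathrm{Gpd}_R(M)\leq 1$, there exists a short exact sequence of $R$-modules $0\rightarrow M\rightarrow Q\rightarrow M\rightarrow 0$ with $\mathrm{pd}_R(Q)\leq 1$.
   Context: All rings are commutative with identity and all modules are unital. $\mathrm{pd}_R$ denotes projective dimension. An $R$-module $M$ is Gorenstein projective if there is an exact complex of projective $R$-modules $\mathbf{P}=\cdots\to P_1\to P_0\to P_{-1}\to\cdots$ with $M\cong \mathrm{Im}(P_0\to P_{-1})$ such that $\mathrm{Hom}_R(\mathbf{P},Q)$ is exact for every projective $R$-module $Q$. An $R$-module $M$ is strongly Gorenstein projective if there is an exact sequence $\mathbf{P}=\cdots\to P\xrightarrow{f}P\xrightarrow{f}P\xrightarrow{f}P\to\cdots$ in which all modules are the same projective $R$-module $P$ and all maps are the same map $f$, such that $M\cong\mathrm{Im}(f)$ and $\mathrm{Hom}_R(\mathbf{P},Q)$ is exact for every projective $R$-module $Q$. The Gorenstein projective dimension $\mathrm{Gpd}_R(M)$ is the least integer $n\geq 0$ for which there is an exact sequence $0\to G_n\to\cdots\to G_0\to M\to 0$ with all $G_i$ Gorenstein projective ($\infty$ if no such $n$ exists). *)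

(* Defs.v *)
From HB Require Import structures.
From mathcomp Require Import all_boot all_order all_algebra.
From mathcomp Require Import boolp.

Set Implicit Arguments.
Unset Strict Implicit.
Unset Printing Implicit Defensive.

Import GRing.Theory.
Local Open Scope ring_scope.

Definition surjective (A B : Type) (f : A -> B) : Prop :=
  forall y, exists x, f x = y.

Definition isomorphic (R : comPzRingType) (M N : lmodType R) : Prop :=
  exists f : {linear M -> N}, bijective f.

Definition im_pred (R : comPzRingType) (M N : lmodType R)
    (f : {linear M -> N}) : {pred N} :=
  fun y => `[< exists x, f x = y >].

Lemma im_submod_closed (R : comPzRingType) (M N : lmodType R)
  (f : {linear M -> N}) : submod_closed (im_pred f).
Proof.
split=> [|a _ _ /asboolP[x <-] /asboolP[y <-]]; apply/asboolP.
  by exists 0; rewrite linear0.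
by exists (a *: x + y); rewrite linearP.
Qed.

HB.instance Definition _ (R : comPzRingType) (M N : lmodType R)
    (f : {linear M -> N}) :=
  GRing.isSubmodClosed.Build R N (im_pred f) (im_submod_closed f).

Record im (R : comPzRingType) (M N : lmodType R) (f : {linear M -> N}) :=
  Im { im_val :> N; im_valP : im_val \in im_pred f }.

HB.instance Definition _ (R : comPzRingType) (M N : lmodType R)
  (f : {linear M -> N}) := [isSub for @im_val R M N f].
HB.instance Definition _ (R : comPzRingType) (M N : lmodType R)
  (f : {linear M -> N}) := [Choice of im f by <:].
HB.instance Definition _ (R : comPzRingType) (M N : lmodType R)
  (f : {linear M -> N}) := [SubChoice_isSubLmodule of im f by <:].

Definition exact_at (R : comPzRingType) (A B C : lmodType R)
    (f : {linear A -> B}) (g : {linear B -> C}) : Prop :=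
  forall y, g y = 0 <-> exists x, f x = y.

(* Exactness of Hom(C, Q) -> Hom(B, Q) -> Hom(A, Q) at Hom(B, Q). *)
Definition hom_exact_at (R : comPzRingType) (A B C : lmodType R)
    (f : {linear A -> B}) (g : {linear B -> C}) (Q : lmodType R) : Prop :=
  forall h : {linear B -> Q},
    (forall x, h (f x) = 0) <->
    exists k : {linear C -> Q}, forall y, k (g y) = h y.

Definition short_exact (R : comPzRingType) (A B C : lmodType R)
    (f : {linear A -> B}) (g : {linear B -> C}) : Prop :=
  [/\ injective f, exact_at f g & surjective g].

Definition projective (R : comPzRingType) (P : lmodType R) : Prop :=
  forall (M N : lmodType R) (g : {linear M -> N}) (f : {linear P -> N}),
    surjective g -> exists h : {linear P -> M}, forall x, g (h x) = f x.

(* An exact complex of projectives ... -> P 1 -> P 0 -> P (-1) -> ..., with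
   d i : P i -> P (i - 1), that stays exact under Hom(-, Q) for Q projective. *)
Definition complete_projective_resolution (R : comPzRingType)
    (P : int -> lmodType R) (d : forall i, {linear P i -> P (i - 1)}) : Prop :=
  [/\ forall i, projective (P i),
      forall i, exact_at (d i) (d (i - 1)) &
      forall Q : lmodType R, projective Q ->
        forall i, hom_exact_at (d i) (d (i - 1)) Q].

Definition Gorenstein_projective (R : comPzRingType) (M : lmodType R) : Prop :=
  exists (P : int -> lmodType R) (d : forall i, {linear P i -> P (i - 1)}),
    complete_projective_resolution d /\ isomorphic M (im (d 0)).

Definition strongly_Gorenstein_projective (R : comPzRingType)
    (M : lmodType R) : Prop :=
  exists (P : lmodType R) (f : {linear P -> P}),
    @complete_projective_resolution R (fun=> P) (fun=> f) /\
    isomorphic M (im f).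

(* An exact sequence 0 -> G n -> ... -> G 0 -> M -> 0 with every G i in the
   class X; the sequence is continued by zero modules in degrees above n. *)
Definition has_resolution (R : comPzRingType) (X : lmodType R -> Prop)
    (M : lmodType R) (n : nat) : Prop :=
  exists (G : nat -> lmodType R) (d : forall i, {linear G i.+1 -> G i})
         (e : {linear G 0%N -> M}),
    [/\ forall i, (i <= n)%N -> X (G i),
        forall i, (n < i)%N -> forall x : G i, x = 0,
        forall i, exact_at (d i.+1) (d i),
        exact_at (d 0%N) e &
        surjective e].

(* The least n satisfying p, with None standing for infinity. *)
Definition least (p : nat -> Prop) : option nat :=
  match pselect (exists n, `[< p n >]) with
  | left ex_p => Some (ex_minn ex_p)
  | right _ => None
  end.

Definition dim_le (d : option nat) (n : nat) : Prop :=
  if d is Some m then (m <= n)%N else False.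

Definition pd (R : comPzRingType) (M : lmodType R) : option nat :=
  least (has_resolution (@projective R) M).

Definition Gpd (R : comPzRingType) (M : lmodType R) : option nat :=
  least (has_resolution (@Gorenstein_projective R) M).

(* Main.v *)
Require Import Defs.
From mathcomp Require Import all_boot all_order all_algebra.
From HB Require Import structures.
From mathcomp Require Import boolp.

Set Implicit Arguments.
Unset Strict Implicit.
Unset Printing Implicit Defensive.

Import GRing.Theory.
Local Open Scope ring_scope.
Local Open Scope quotient_scope.

(** The whole argument runs on short exact sequences rather than on complexes.
A Gorenstein projective module is one that belongs to some class of modules
whose members M have Ext^1(M, Q) = 0 for all projective Q, embed in a
projective with cokernel in the class, and are quotients of a projective with
kernel in the class ([Gorenstein_projective_of_closed],
[syzygy_closed_Gorenstein_projective]): splicing the sequences together in both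
directions gives the complete resolution.  In the same way, M is strongly
Gorenstein projective exactly when Ext^1(M, Q) = 0 for all projective Q and
there is an exact sequence 0 -> M -> P -> M -> 0 with P projective.

From (1) to (2).  A module M with Gpd M <= 1 has an exact sequence
0 -> G1 -> G0 -> M -> 0 with Gorenstein projective G1, G0.  Pushing out along
an embedding of G1 in a projective P with Gorenstein projective cokernel turns
it into 0 -> P -> D -> M -> 0, where D is an extension of Gorenstein
projectives, hence Gorenstein projective
([Gorenstein_projective_extension], [projective_kernel_resolution]).  By (1)
there is 0 -> D -> F -> D -> 0 with F projective; the sequence
0 -> P -> P + P -> P -> 0 maps into it, and the cokernels of the three vertical
maps form a sequence 0 -> M -> Q -> M -> 0 by the nine lemma, with Q the
quotient of F by P + P, so that pd Q <= 1
([self_extension_of_projective_kernel]).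

From (2) to (1).  If M is Gorenstein projective, (2) gives
0 -> M -> Q -> M -> 0 and 0 -> P1 -> P0 -> Q -> 0 with P1, P0 projective.  The
long exact sequence yields Ext^1(Q, P1) = 0, so the second sequence splits and Q
is projective, and the first sequence makes M strongly Gorenstein
projective. *)

(** * Submodules, quotients and induced maps *)

(** Maps defined by choice come as bare functions; this packs them as linear
maps without committing to a global instance. *)
Lemma linear_of (R : comPzRingType) (M N : lmodType R) (k : M -> N) :
  linear k -> exists g : {linear M -> N}, g =1 k.
Proof.
move=> lin_k; pose L := GRing.isLinear.Build _ _ _ _ k lin_k.
by exists (HB.pack_for {linear M -> N} k L).
Qed.

Lemma linear_injective (R : comPzRingType) (M N : lmodType R)
    (f : {linear M -> N}) :
  (forall x, f x = 0 -> x = 0) -> injective f.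
Proof. exact: raddf_inj. Qed.

(** The universal property of a quotient.  The induced maps of the diagram chases
come from this lemma or from its dual [factor_through_injection]. *)
Lemma factor_through_surjection (R : comPzRingType) (X Y Z : lmodType R)
    (q : {linear X -> Y}) (h : {linear X -> Z}) :
  surjective q -> (forall x, q x = 0 -> h x = 0) ->
  exists k : {linear Y -> Z}, forall x, k (q x) = h x.
Proof.
move=> /choice[s qs] h0.
have hs x : h (s (q x)) = h x.
  by apply/eqP; rewrite -subr_eq0 -linearB h0 // linearB /= qs subrr.
have [|k kE] := @linear_of R Y Z (h \o s).
  by move=> a u v /=; rewrite -linearP -[RHS]hs linearP /= !qs.
by exists k => x; rewrite kE /= hs.
Qed.

Lemma factor_through_injection (R : comPzRingType) (X Y Z : lmodType R)
    (i : {linear Y -> Z}) (h : {linear X -> Z}) :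
  injective i -> (forall x, exists y, i y = h x) ->
  exists k : {linear X -> Y}, forall x, i (k x) = h x.
Proof.
move=> inj_i /choice[s is_].
have [|k kE] := @linear_of R X Y s.
  by move=> a u v; apply: inj_i; rewrite linearP !is_ linearP.
by exists k => x; rewrite kE.
Qed.

Definition ker_pred (R : comPzRingType) (M N : lmodType R)
  (f : {linear M -> N}) : {pred M} := fun x => f x == 0.

Lemma ker_submod_closed (R : comPzRingType) (M N : lmodType R)
  (f : {linear M -> N}) : submod_closed (ker_pred f).
Proof.
split=> [|a x y /eqP fx /eqP fy]; apply/eqP; first by rewrite linear0.
by rewrite linearP fx fy scaler0 addr0.
Qed.

HB.instance Definition _ (R : comPzRingType) (M N : lmodType R)
    (f : {linear M -> N}) :=
  GRing.isSubmodClosed.Build R M (ker_pred f) (ker_submod_closed f).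

Record ker (R : comPzRingType) (M N : lmodType R) (f : {linear M -> N}) :=
  Ker { ker_val :> M; ker_valP : ker_val \in ker_pred f }.

HB.instance Definition _ (R : comPzRingType) (M N : lmodType R)
  (f : {linear M -> N}) := [isSub for @ker_val R M N f].
HB.instance Definition _ (R : comPzRingType) (M N : lmodType R)
  (f : {linear M -> N}) := [Choice of ker f by <:].
HB.instance Definition _ (R : comPzRingType) (M N : lmodType R)
  (f : {linear M -> N}) := [SubChoice_isSubLmodule of ker f by <:].

Lemma exists_kernel (R : comPzRingType) (M N : lmodType R)
    (f : {linear M -> N}) :
  exists (K : lmodType R) (i : {linear K -> M}), injective i /\ exact_at i f.
Proof.
exists (ker f), (\val : {linear ker f -> M}); split; first exact: val_inj.
move=> y; split=> [fy|[x <-]]; last exact/eqP/(valP x).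
have yK : y \in ker_pred f by apply/eqP.
by exists (Ker yK).
Qed.

Definition coker (R : comPzRingType) (M N : lmodType R)
  (f : {linear M -> N}) := Quotient.quot (im_pred f).
HB.instance Definition _ (R : comPzRingType) (M N : lmodType R)
  (f : {linear M -> N}) := GRing.Zmodule.on (coker f).
HB.instance Definition _ (R : comPzRingType) (M N : lmodType R)
  (f : {linear M -> N}) := ZmodQuotient.on (coker f).

Lemma coker_eq (R : comPzRingType) (M N : lmodType R) (f : {linear M -> N})
  (x y : N) : \pi_(coker f) x = \pi y <-> exists z, f z = x - y.
Proof.
split=> [/eqmodP /=|]; first by rewrite /Quotient.equiv=> /asboolP.
by move=> h; apply/eqmodP; apply/asboolP.
Qed.

Definition coker_scale (R : comPzRingType) (M N : lmodType R)
  (f : {linear M -> N}) a (x : coker f) : coker f := \pi_(coker f) (a *: repr x).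

Lemma coker_scale_pi (R : comPzRingType) (M N : lmodType R)
    (f : {linear M -> N}) a (x : N) :
  coker_scale a (\pi_(coker f) x) = \pi_(coker f) (a *: x).
Proof.
apply/coker_eq.
have /coker_eq[z zE] : \pi_(coker f) (repr (\pi_(coker f) x)) = \pi x.
  by rewrite reprK.
by exists (a *: z); rewrite linearZ /= zE scalerBr.
Qed.

Lemma coker_scaleA (R : comPzRingType) (M N : lmodType R)
    (f : {linear M -> N}) a b (v : coker f) :
  coker_scale a (coker_scale b v) = coker_scale (a * b) v.
Proof.
by elim/quotW: v => v; rewrite (coker_scale_pi f b) !coker_scale_pi scalerA.
Qed.

Lemma coker_scale1 (R : comPzRingType) (M N : lmodType R)
  (f : {linear M -> N}) : left_id 1 (@coker_scale R M N f).
Proof. by elim/quotW=> v; rewrite coker_scale_pi scale1r. Qed.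

Lemma coker_scaleDr (R : comPzRingType) (M N : lmodType R)
  (f : {linear M -> N}) : right_distributive (@coker_scale R M N f) +%R.
Proof.
move=> a; elim/quotW=> u; elim/quotW=> v.
by rewrite !coker_scale_pi -!pi_addr !coker_scale_pi scalerDr.
Qed.

Lemma coker_scaleDl (R : comPzRingType) (M N : lmodType R)
    (f : {linear M -> N}) (v : coker f) :
  {morph (@coker_scale R M N f)^~ v : a b / a + b}.
Proof.
by elim/quotW: v => u a b; rewrite !coker_scale_pi scalerDl -!pi_addr.
Qed.

HB.instance Definition _ (R : comPzRingType) (M N : lmodType R)
    (f : {linear M -> N}) :=
  GRing.Zmodule_isLmodule.Build R (coker f) (@coker_scaleA R M N f)
    (@coker_scale1 R M N f) (@coker_scaleDr R M N f) (@coker_scaleDl R M N f).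

Lemma exists_cokernel (R : comPzRingType) (M N : lmodType R)
    (f : {linear M -> N}) :
  exists (C : lmodType R) (q : {linear N -> C}), exact_at f q /\ surjective q.
Proof.
have [|q qE] := @linear_of R N (coker f) \pi_(coker f).
  by move=> a u v; rewrite pi_addr -coker_scale_pi.
exists (coker f), q; split=> [y|].
  rewrite qE -(linear0 q) qE; split=> [/coker_eq[x fx]|[x fx]].
    by exists x; rewrite fx subr0.
  by apply/coker_eq; exists x; rewrite subr0.
by elim/quotW=> x; exists x; rewrite qE.
Qed.

(** * Short exact sequences *)

Lemma short_exact_comp0 (R : comPzRingType) (A B C : lmodType R)
    (i : {linear A -> B}) (p : {linear B -> C}) x :
  short_exact i p -> p (i x) = 0.
Proof. by case=> _ ex _; apply/ex; exists x. Qed.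

Lemma short_exact_lift (R : comPzRingType) (A B C : lmodType R)
    (i : {linear A -> B}) (p : {linear B -> C}) y :
  short_exact i p -> p y = 0 -> exists x, i x = y.
Proof. by case=> _ ex _ /ex. Qed.

Lemma short_exact_map0 (R : comPzRingType) (A B C : lmodType R)
    (i : {linear A -> B}) (p : {linear B -> C}) x :
  short_exact i p -> i x = 0 -> x = 0.
Proof. by case=> inj _ _ ix; apply: inj; rewrite linear0. Qed.

(** The injective half of the short five lemma. *)
Lemma injective_middle (R : comPzRingType) (A B C A1 B1 C1 : lmodType R)
    (i : {linear A -> B}) (p : {linear B -> C})
    (i1 : {linear A1 -> B1}) (p1 : {linear B1 -> C1})
    (u : {linear A -> A1}) (v : {linear B -> B1}) (w : {linear C -> C1}) :
  short_exact i p -> short_exact i1 p1 ->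
  (forall x, v (i x) = i1 (u x)) -> (forall y, w (p y) = p1 (v y)) ->
  injective u -> injective w -> injective v.
Proof.
move=> sp sp1 vi wp inj_u inj_w; apply: linear_injective => y vy.
have [|x xE] := short_exact_lift (y := y) sp.
  by apply: inj_w; rewrite wp vy !linear0.
have : u x = 0 by apply: (short_exact_map0 sp1); rewrite -vi xE.
by rewrite -xE -(linear0 u) => /inj_u ->; rewrite linear0.
Qed.

(** The surjective half of the short five lemma. *)
Lemma surjective_middle (R : comPzRingType) (A B C A1 B1 C1 : lmodType R)
    (i : {linear A -> B}) (p : {linear B -> C})
    (i1 : {linear A1 -> B1}) (p1 : {linear B1 -> C1})
    (u : {linear A -> A1}) (v : {linear B -> B1}) (w : {linear C -> C1}) :
  short_exact i p -> short_exact i1 p1 ->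
  (forall x, v (i x) = i1 (u x)) -> (forall y, w (p y) = p1 (v y)) ->
  surjective u -> surjective w -> surjective v.
Proof.
move=> [_ _ surj_p] sp1 vi wp surj_u surj_w y1.
have [c cE] := surj_w (p1 y1); have [y yE] := surj_p c.
have [|x1 x1E] := short_exact_lift (y := y1 - v y) sp1.
  by rewrite linearB /= -wp yE cE subrr.
have [x xE] := surj_u x1.
by exists (y + i x); rewrite linearD /= vi xE x1E addrC subrK.
Qed.

(** Nine lemma: the cokernels of a map of short exact sequences with injective
components form a short exact sequence.  This is the snake lemma with vanishing
kernels. *)
Lemma nine_cokernels (R : comPzRingType)
    (A B C A1 B1 C1 A2 B2 C2 : lmodType R)
    (i : {linear A -> B}) (p : {linear B -> C})
    (i1 : {linear A1 -> B1}) (p1 : {linear B1 -> C1})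
    (u : {linear A -> A1}) (u1 : {linear A1 -> A2})
    (v : {linear B -> B1}) (v1 : {linear B1 -> B2})
    (w : {linear C -> C1}) (w1 : {linear C1 -> C2}) :
  short_exact i p -> short_exact i1 p1 ->
  short_exact u u1 -> short_exact v v1 -> short_exact w w1 ->
  (forall x, v (i x) = i1 (u x)) -> (forall y, w (p y) = p1 (v y)) ->
  exists (i2 : {linear A2 -> B2}) (p2 : {linear B2 -> C2}), short_exact i2 p2.
Proof.
move=> sp sp1 su sv sw vi wp.
have surj_p : surjective p by case: sp.
have [_ _ surj_p1] := sp1; have [_ _ surj_u1] := su.
have [_ _ surj_v1] := sv; have [_ _ surj_w1] := sw.
have [|i2 i2E] := factor_through_surjection (h := v1 \o i1) surj_u1.
  move=> x1 /(short_exact_lift su)[x <-] /=.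
  by rewrite -vi (short_exact_comp0 _ sv).
have [|p2 p2E] := factor_through_surjection (h := w1 \o p1) surj_v1.
  move=> y1 /(short_exact_lift sv)[y <-] /=.
  by rewrite -wp (short_exact_comp0 _ sw).
exists i2, p2; split.
- apply: linear_injective => x2; have [x1 <-] := surj_u1 x2.
  rewrite i2E /= => /(short_exact_lift sv)[y yE].
  have [|x xE] := short_exact_lift (y := y) sp.
    by apply: (short_exact_map0 sw); rewrite wp yE (short_exact_comp0 _ sp1).
  have -> : x1 = u x.
    by have [inj_i1 _ _] := sp1; apply: inj_i1; rewrite -vi xE.
  exact: short_exact_comp0 su.
- move=> y2; split=> [|[x2 <-]]; last first.
    have [x1 <-] := surj_u1 x2.
    by rewrite i2E /= p2E /= (short_exact_comp0 _ sp1) linear0.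
  have [y1 <-] := surj_v1 y2.
  rewrite p2E /= => /(short_exact_lift sw)[c cE].
  have [y yE] := surj_p c.
  have [|x1 x1E] := short_exact_lift (y := y1 - v y) sp1.
    by rewrite linearB /= -wp yE cE subrr.
  exists (u1 x1).
  by rewrite i2E /= x1E linearB /= (short_exact_comp0 _ sv) subr0.
- move=> z2; have [z1 <-] := surj_w1 z2; have [y1 <-] := surj_p1 z1.
  by exists (v1 y1); rewrite p2E.
Qed.

(** The dual half of the nine lemma, for kernels of surjective components. *)
Lemma nine_kernels (R : comPzRingType)
    (A B C A1 B1 C1 A2 B2 C2 : lmodType R)
    (i1 : {linear A1 -> B1}) (p1 : {linear B1 -> C1})
    (i2 : {linear A2 -> B2}) (p2 : {linear B2 -> C2})
    (u : {linear A -> A1}) (u1 : {linear A1 -> A2})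
    (v : {linear B -> B1}) (v1 : {linear B1 -> B2})
    (w : {linear C -> C1}) (w1 : {linear C1 -> C2}) :
  short_exact i1 p1 -> short_exact i2 p2 ->
  short_exact u u1 -> short_exact v v1 -> short_exact w w1 ->
  (forall x, v1 (i1 x) = i2 (u1 x)) -> (forall y, w1 (p1 y) = p2 (v1 y)) ->
  exists (i : {linear A -> B}) (p : {linear B -> C}), short_exact i p.
Proof.
move=> sp1 sp2 su sv sw v1i w1p.
have [_ _ surj_p1] := sp1; have [_ _ surj_u1] := su.
have [inj_v _ _] := sv; have [inj_w _ _] := sw.
have [|i iE] := factor_through_injection (h := i1 \o u) inj_v.
  move=> x /=; apply: (short_exact_lift sv).
  by rewrite v1i (short_exact_comp0 _ su) linear0.
have [|p pE] := factor_through_injection (h := p1 \o v) inj_w.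
  move=> y /=; apply: (short_exact_lift sw).
  by rewrite w1p (short_exact_comp0 _ sv) linear0.
exists i, p; split.
- apply: linear_injective => x ix; apply: (short_exact_map0 su).
  by apply: (short_exact_map0 sp1); rewrite -[i1 _]iE ix linear0.
- move=> y; split=> [py|[x <-]]; last first.
    apply: (short_exact_map0 sw).
    by rewrite pE /= iE /= (short_exact_comp0 _ sp1).
  have [|x1 x1E] := short_exact_lift (y := v y) sp1.
    by rewrite -[p1 _]pE py linear0.
  have [|x xE] := short_exact_lift (y := x1) su.
    by apply: (short_exact_map0 sp2); rewrite -v1i x1E (short_exact_comp0 _ sv).
  by exists x; apply: inj_v; rewrite iE /= xE.
- move=> c; have [y1 y1E] := surj_p1 (w c).
  have [|x2 x2E] := short_exact_lift (y := v1 y1) sp2.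
    by rewrite -w1p y1E (short_exact_comp0 _ sw).
  have [x1 x1E] := surj_u1 x2.
  have [|y yE] := short_exact_lift (y := y1 - i1 x1) sv.
    by rewrite linearB /= v1i x1E x2E subrr.
  exists y; apply: inj_w.
  by rewrite pE /= yE linearB /= (short_exact_comp0 _ sp1) subr0.
Qed.

(** * Direct sums and the vanishing of Ext *)

Lemma copair (R : comPzRingType) (A B C : lmodType R)
    (f : {linear A -> C}) (g : {linear B -> C}) :
  exists h : {linear (A * B)%type -> C}, forall x y, h (x, y) = f x + g y.
Proof. by exists ((f \o fst) \+ (g \o snd)). Qed.

Lemma pairing (R : comPzRingType) (A B C : lmodType R)
    (f : {linear C -> A}) (g : {linear C -> B}) :
  exists h : {linear C -> (A * B)%type}, forall x, h x = (f x, g x).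
Proof.
have [|h hE] := @linear_of R C (A * B)%type (fun x => (f x, g x)).
  by move=> a x y; rewrite !linearP.
by exists h.
Qed.

Lemma split_short_exact (R : comPzRingType) (A B : lmodType R) :
  exists (i : {linear A -> (A * B)%type}) (p : {linear (A * B)%type -> B}),
    [/\ short_exact i p, forall x, i x = (x, 0) & forall x, p x = x.2].
Proof.
have [i iE] := @pairing R A B A idfun \0.
exists i, (snd : {linear (A * B)%type -> B}); split=> //; split.
- by move=> x y; rewrite !iE => -[].
- case=> x y; split=> /= [->|[z]]; last by rewrite iE => -[].
  by exists x; rewrite iE.
- by move=> y; exists (0, y).
Qed.

Lemma split_short_exact_sym (R : comPzRingType) (A B : lmodType R) :
  exists (i : {linear B -> (A * B)%type}) (p : {linear (A * B)%type -> A}),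
    [/\ short_exact i p, forall x, i x = (0, x) & forall x, p x = x.1].
Proof.
have [i iE] := @pairing R A B B \0 idfun.
exists i, (fst : {linear (A * B)%type -> A}); split=> //; split.
- by move=> x y; rewrite !iE => -[].
- case=> x y; split=> /= [->|[z]]; last by rewrite iE => -[].
  by exists y; rewrite iE.
- by move=> y; exists (y, 0).
Qed.

Lemma short_exact_id (R : comPzRingType) (Z M : lmodType R) :
  (forall z : Z, z = 0) ->
  short_exact (\0 : {linear Z -> M}) (idfun : {linear M -> M}).
Proof.
move=> Z0; split=> [x y _|y|y]; first by rewrite (Z0 x) (Z0 y).
  by split=> /= [->|[x <-]] //; exists 0.
by exists y.
Qed.

Lemma short_exact_id0 (R : comPzRingType) (M Z : lmodType R) :
  (forall z : Z, z = 0) ->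
  short_exact (idfun : {linear M -> M}) (\0 : {linear M -> Z}).
Proof.
move=> Z0; split=> [x y //|y|y]; last by exists 0; rewrite (Z0 y).
by split=> // _; exists y.
Qed.

Lemma exists_zero_module (R : comPzRingType) :
  exists Z : lmodType R, forall z : Z, z = 0.
Proof. by exists 'rV[R]_0 => z; rewrite thinmx0. Qed.

Lemma projective_zero (R : comPzRingType) (Z : lmodType R) :
  (forall z : Z, z = 0) -> projective Z.
Proof.
by move=> Z0 M N g f _; exists \0 => x; rewrite (Z0 x) !linear0.
Qed.

Lemma projective_sum (R : comPzRingType) (P Q : lmodType R) :
  projective P -> projective Q -> projective (P * Q)%type.
Proof.
move=> projP projQ M N g f surj_g.
have [i [_ [_ iE _]]] := split_short_exact P Q.
have [j [_ [_ jE _]]] := split_short_exact_sym P Q.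
have [h hE] := projP _ _ g (f \o i) surj_g.
have [k kE] := projQ _ _ g (f \o j) surj_g.
have [l lE] := copair h k.
exists l => -[x y]; rewrite lE linearD hE kE /= -linearD iE jE.
by congr (f (_, _)); rewrite /= ?addr0 ?add0r.
Qed.

(** Ext^1(M, Q) = 0, read off the long exact sequence: maps into Q extend along
every monomorphism with cokernel M.  This avoids choosing a resolution of M, and
it is the form in which the vanishing gets used. *)
Definition Ext1_vanish (R : comPzRingType) (M Q : lmodType R) : Prop :=
  forall (A B : lmodType R) (i : {linear A -> B}) (p : {linear B -> M}),
    short_exact i p -> forall h : {linear A -> Q},
    exists k : {linear B -> Q}, forall x, k (i x) = h x.

(** The vanishing of Ext^1(M, Q) can be tested on one presentation of M by a
projective P: for any 0 -> A -> B -> M -> 0, the module B is the pushout of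
K -> P along the map K -> A obtained by lifting P -> M to B, so that an
extension to P of the composite K -> A -> Q glues with A -> Q. *)
Lemma Ext1_vanish_presentation (R : comPzRingType) (K P M Q : lmodType R)
    (j : {linear K -> P}) (q : {linear P -> M}) :
  short_exact j q -> projective P ->
  (forall h : {linear K -> Q},
     exists k : {linear P -> Q}, forall x, k (j x) = h x) ->
  Ext1_vanish M Q.
Proof.
move=> sq projP extend A B i p sp h.
have [inj_i _ surj_p] := sp.
have [l lE] := projP _ _ p q surj_p.
have [|m mE] := factor_through_injection (h := l \o j) inj_i.
  move=> x; apply: (short_exact_lift sp).
  by rewrite /= lE (short_exact_comp0 _ sq).
have [u uE] := extend (h \o m).
have [r rE] := copair i l; have [v vE] := copair h u.
have surj_r : surjective r.
  move=> y; have [_ _ surj_q] := sq; have [x xE] := surj_q (p y).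
  have [|a aE] := short_exact_lift (y := y - l x) sp.
    by rewrite linearB /= lE xE subrr.
  by exists (a, x); rewrite rE aE subrK.
have [|k kE] := factor_through_surjection (h := v) surj_r.
  case=> a x; rewrite rE vE => ix.
  have [|y yE] := short_exact_lift (y := x) sq.
    have /(congr1 p) := ix.
    by rewrite linearD linear0 /= lE (short_exact_comp0 _ sp) add0r.
  have -> : a = - m y.
    by apply: inj_i; rewrite linearN mE /= yE; apply/eqP; rewrite -addr_eq0 ix.
  by rewrite -yE uE linearN /= addNr.
by exists k => x; rewrite -[i x]addr0 -(linear0 l) -rE kE vE linear0 addr0.
Qed.

(** Exactness of Ext^1(B, Q) -> Ext^1(D, Q) -> Ext^1(A, Q) in the middle.  Given
0 -> K -> E -> D -> 0, the preimage E' of A in E lies between K and E with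
subquotients A and B, and a map out of K is extended in two steps. *)
Lemma Ext1_vanish_extension (R : comPzRingType) (A D B Q : lmodType R)
    (i : {linear A -> D}) (p : {linear D -> B}) :
  short_exact i p -> Ext1_vanish A Q -> Ext1_vanish B Q -> Ext1_vanish D Q.
Proof.
move=> sp extA extB K E j q sq h.
have [inj_i _ surj_p] := sp; have [inj_j _ surj_q] := sq.
have [E' [e [inj_e exact_e]]] := exists_kernel (p \o q).
have se : short_exact e (p \o q).
  split=> // b; have [d <-] := surj_p b; have [x <-] := surj_q d.
  by exists x.
have [|j' j'E] := factor_through_injection (h := j) inj_e.
  by move=> x; apply/exact_e; rewrite /= (short_exact_comp0 _ sq) linear0.
have [|q' q'E] := factor_through_injection (h := q \o e) inj_i.
  by move=> x; apply: (short_exact_lift sp); exact: (short_exact_comp0 _ se).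
have sq' : short_exact j' q'.
  split.
  - by move=> x y /(congr1 e); rewrite !j'E => /inj_j.
  - move=> y; split=> [q'y|[x <-]].
      have [|x xE] := short_exact_lift (y := e y) sq.
        by rewrite -[q _]q'E q'y linear0.
      by exists x; apply: inj_e; rewrite j'E.
    by apply: inj_i; rewrite q'E /= j'E (short_exact_comp0 _ sq) linear0.
  - move=> a; have [x xE] := surj_q (i a).
    have [|y yE] := short_exact_lift (y := x) se.
      by rewrite /= xE (short_exact_comp0 _ sp).
    by exists y; apply: inj_i; rewrite q'E /= yE.
have [h' h'E] := extA _ _ _ _ sq' h.
have [k kE] := extB _ _ _ _ se h'.
by exists k => x; rewrite -j'E kE h'E.
Qed.

Lemma Ext1_vanish_projective (R : comPzRingType) (P Q : lmodType R) :
  projective P -> Ext1_vanish P Q.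
Proof.
move=> projP; have [Z Z0] := exists_zero_module R.
apply: (Ext1_vanish_presentation (short_exact_id P Z0) projP) => h.
by exists \0 => x; rewrite (Z0 x) !linear0.
Qed.

(** A retraction of P1 -> P0, which exists because Ext^1(Q, P1) = 0, makes Q a
direct summand of P0. *)
Lemma projective_of_Ext1_vanish (R : comPzRingType) (P1 P0 Q : lmodType R)
    (i : {linear P1 -> P0}) (p : {linear P0 -> Q}) :
  short_exact i p -> projective P0 -> Ext1_vanish Q P1 -> projective Q.
Proof.
move=> sp projP0 extQ M N g f surj_g.
have [r rE] := extQ _ _ _ _ sp idfun.
have [_ _ surj_p] := sp.
(* id - i r vanishes on the image of i, so it induces a section of p. *)
have [|s sE] := factor_through_surjection
    (h := (idfun : {linear P0 -> P0}) \- (i \o r)) surj_p.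
  by move=> x /(short_exact_lift sp)[y <-] /=; rewrite rE subrr.
have [h hE] := projP0 _ _ g (f \o p) surj_g.
exists (h \o s) => y; have [x <-] := surj_p y.
by rewrite /= hE /= sE /= linearB /= (short_exact_comp0 _ sp) subr0.
Qed.

(** * Gorenstein projective modules through short exact sequences *)

(** An epi-mono factorization of f through M determines M up to isomorphism, and
is easier to chase through than an isomorphism with the submodule [im f]. *)
Definition is_image (R : comPzRingType) (A B : lmodType R)
    (f : {linear A -> B}) (M : lmodType R) : Prop :=
  exists (b : {linear A -> M}) (a : {linear M -> B}),
    [/\ surjective b, injective a & forall x, f x = a (b x)].

Lemma is_image_iso (R : comPzRingType) (A B : lmodType R)
    (f : {linear A -> B}) (M : lmodType R) :
  is_image f M <-> isomorphic M (im f).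
Proof.
split=> [[b [a [surj_b inj_a fE]]]|[g [g' gK g'K]]].
  have [|g gE] := @factor_through_injection R M (im f) B \val a val_inj.
    move=> m; have [x xE] := surj_b m.
    have aP : a m \in im_pred f by apply/asboolP; exists x; rewrite fE xE.
    by exists (Im aP).
  have [s sK] := choice surj_b.
  have /choice[t tE] (y : im f) : exists m, a m = \val y.
    by have /asboolP[x xE] := valP y; exists (b x); rewrite -fE.
  exists g, t => [m|y]; first by apply: inj_a; rewrite tE gE.
  by apply: val_inj; rewrite gE tE.
have [|b bE] := @factor_through_injection R A (im f) B \val f val_inj.
  move=> x; have fP : f x \in im_pred f by apply/asboolP; exists x.
  by exists (Im fP).
have [|c cE] := @linear_of R (im f) M g'.
  by move=> r u v; apply: (can_inj gK); rewrite linearP !g'K.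
exists (c \o b), (\val \o g); split.
- move=> m; have /asboolP[x xE] := valP (g m); exists x.
  by rewrite /= cE -[RHS]gK; congr g'; apply: val_inj; exact: etrans (bE x) xE.
- by move=> m n /= /val_inj /(can_inj gK).
- by move=> x; rewrite /= cE g'K; exact: esym (bE x).
Qed.

Lemma short_exact_images (R : comPzRingType) (A B C M N : lmodType R)
    (f : {linear A -> B}) (g : {linear B -> C})
    (a : {linear M -> B}) (b : {linear A -> M})
    (a' : {linear N -> C}) (b' : {linear B -> N}) :
  exact_at f g -> surjective b -> injective a -> (forall x, f x = a (b x)) ->
  surjective b' -> injective a' -> (forall x, g x = a' (b' x)) ->
  short_exact a b'.
Proof.
move=> ex surj_b inj_a fE surj_b' inj_a' gE; split=> // y; split=> [b'y|[m <-]].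
  have /ex[x <-] : g y = 0 by rewrite gE b'y linear0.
  by exists (b x); rewrite fE.
have [x <-] := surj_b m; apply: inj_a'.
by rewrite linear0 -fE -gE; apply/ex; exists x.
Qed.

Definition embeds_with_cokernel (R : comPzRingType) (M N : lmodType R) : Prop :=
  exists (P : lmodType R) (a : {linear M -> P}) (b : {linear P -> N}),
    projective P /\ short_exact a b.

(** A coinductive presentation of Gorenstein projectivity: the Gorenstein
projective modules form the largest class that is closed in this sense.
Two-sided complexes indexed by the integers then only occur in the proof of that
fact. *)
Definition syzygy_closed (R : comPzRingType) (X : lmodType R -> Prop) : Prop :=
  forall M, X M ->
    [/\ forall Q, projective Q -> Ext1_vanish M Q,
        exists N, X N /\ embeds_with_cokernel M N &
        exists N, X N /\ embeds_with_cokernel N M].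

(** Exactness of Hom(-, Q) at P (i - 1) comes from extending a map
M (i - 2) -> Q along M (i - 2) -> P (i - 2), whose cokernel is M (i - 3). *)
Lemma complete_resolution_splice (R : comPzRingType) (M P : int -> lmodType R)
    (a : forall i, {linear M i -> P i})
    (b : forall i, {linear P i -> M (i - 1)}) :
  (forall i, short_exact (a i) (b i)) -> (forall i, projective (P i)) ->
  (forall i Q, projective Q -> Ext1_vanish (M i) Q) ->
  complete_projective_resolution (fun i => a (i - 1) \o b i).
Proof.
move=> sab projP extM; split=> // [i y|Q projQ i h].
  have [_ _ surj_b] := sab i; have [inj_a _ _] := sab (i - 1 - 1).
  split=> /= [aby|[x <-]].
    have [|m mE] := short_exact_lift (y := y) (sab (i - 1)).
      exact: short_exact_map0 (sab _) aby.
    by have [x xE] := surj_b m; exists x; rewrite xE.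
  by rewrite (short_exact_comp0 _ (sab (i - 1))) linear0.
have [_ _ surj_b] := sab i; have [_ _ surj_b'] := sab (i - 1).
split=> [h0 | [k kE] x]; last first.
  by rewrite -kE /= (short_exact_comp0 _ (sab (i - 1))) !linear0.
have [|h' h'E] := factor_through_surjection (h := h) surj_b'.
  move=> y /(short_exact_lift (sab _))[m <-].
  by have [x <-] := surj_b m; exact: h0.
have [k kE] := extM _ _ projQ _ _ _ _ (sab (i - 1 - 1)) h'.
by exists k => y; rewrite /= kE h'E.
Qed.

Lemma is_image_comp (R : comPzRingType) (L M N : lmodType R)
    (b : {linear L -> M}) (a : {linear M -> N}) :
  surjective b -> injective a -> is_image (a \o b) M.
Proof. by exists b, a. Qed.

(** Dependent choice in both directions.  The starting point sits at index -1
because the module resolved by a complex d is the image of d 0, which lies in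
degree -1. *)
Lemma bi_infinite_chain (T : Type) (X : T -> Prop) (r : T -> T -> Prop) (t : T) :
  (forall x, X x -> exists y, X y /\ r x y) ->
  (forall x, X x -> exists y, X y /\ r y x) -> X t ->
  exists s : int -> T,
    [/\ s (-1) = t, forall i, X (s i) & forall i, r (s i) (s (i - 1))].
Proof.
move=> next prev Xt.
have /choice[f fP] (x : {x | X x}) : exists y : {x | X x}, r (sval x) (sval y).
  by case: x => x Xx; have [y [Xy rxy]] := next x Xx; exists (exist _ y Xy).
have /choice[g gP] (x : {x | X x}) : exists y : {x | X x}, r (sval y) (sval x).
  by case: x => x Xx; have [y [Xy rxy]] := prev x Xx; exists (exist _ y Xy).
pose t' : {x | X x} := exist _ t Xt.
exists (fun i => match i with
  | Posz n => sval (iter n.+1 g t')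
  | Negz n => sval (iter n f t')
  end); split=> //.
  by case=> n; exact: proj2_sig.
case=> [[|n]|n]; first exact: gP.
  have -> : n.+1%:Z - 1 = n by rewrite -addn1 PoszD addrK.
  exact: gP.
have -> : Negz n - 1 = Negz n.+1 by rewrite !NegzE -opprD -PoszD addn1.
exact: fP.
Qed.

(** A bi-infinite chain in X starting at M provides short exact sequences that
splice into a complete resolution of M. *)
Lemma Gorenstein_projective_of_closed (R : comPzRingType)
    (X : lmodType R -> Prop) (M : lmodType R) :
  syzygy_closed X -> X M -> Gorenstein_projective M.
Proof.
move=> clX XM.
have [||s [s1 Xs linked]] := bi_infinite_chain (r := @embeds_with_cokernel R) _ _ XM.
- by move=> N /clX[].
- by move=> N /clX[].
pose P i := sval (cid (linked i)).
pose a i : {linear s i -> P i} := sval (cid (svalP (cid (linked i)))).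
pose b i : {linear P i -> s (i - 1)} :=
  sval (cid (svalP (cid (svalP (cid (linked i)))))).
have Pab i : projective (P i) /\ short_exact (a i) (b i).
  exact: svalP (cid (svalP (cid (svalP (cid (linked i)))))).
exists P, (fun i => a (i - 1) \o b i); split.
  apply: complete_resolution_splice => [i|i|i Q projQ]; try by have [] := Pab i.
  by have [ext _ _] := clX _ (Xs i); exact: ext.
apply/is_image_iso; have <- : s (0 - 1) = M by rewrite sub0r.
have [[_ _ surj_b] [inj_a _ _]] := ((Pab 0).2, (Pab (0 - 1)).2).
exact: is_image_comp.
Qed.

(** All the images in a complete resolution are taken at once, which makes the
class stable under shifts without reindexing the complex. *)
Lemma syzygy_closed_images (R : comPzRingType) (P : int -> lmodType R)
    (d : forall i, {linear P i -> P (i - 1)}) :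
  complete_projective_resolution d ->
  syzygy_closed (fun M => exists i, is_image (d i) M).
Proof.
move=> [projP exact_d hom_d] M [i imM].
have image_im j : is_image (d j) (im (d j)).
  by apply/is_image_iso; exists idfun; exists idfun.
split.
- move=> Q projQ.
  have [j jE] : exists j, j - 1 - 1 = i by exists (i + 1 + 1); rewrite !addrK.
  subst i; have [b [a [surj_b inj_a dE]]] := imM.
  have [c [e [surj_c inj_e dE']]] := image_im (j - 1).
  have se := short_exact_images (exact_d _) surj_c inj_e dE' surj_b inj_a dE.
  apply: (Ext1_vanish_presentation se (projP _)) => h.
  have [|k kE] := (hom_d Q projQ j (h \o c)).1.
    move=> x /=; have -> : c (d j x) = 0; last exact: linear0.
    by apply: inj_e; rewrite -dE' linear0; apply/exact_d; exists x.
  by exists k => y; have [x <-] := surj_c y; rewrite -dE' kE.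
- have [b [a [surj_b inj_a dE]]] := imM.
  have [b' [a' [surj_b' inj_a' dE']]] := image_im (i - 1).
  exists (im (d (i - 1))); split; first by exists (i - 1).
  exists (P (i - 1)), a, b'; split; first exact: projP.
  exact: (short_exact_images (exact_d i) surj_b inj_a dE surj_b' inj_a').
- have [j jE] : exists j, j - 1 = i by exists (i + 1); rewrite addrK.
  subst i; have [b [a [surj_b inj_a dE]]] := imM.
  have [b' [a' [surj_b' inj_a' dE']]] := image_im j.
  exists (im (d j)); split; first by exists j.
  exists (P (j - 1)), a', b; split; first exact: projP.
  exact: (short_exact_images (exact_d j) surj_b' inj_a' dE' surj_b inj_a).
Qed.

Lemma syzygy_closed_Gorenstein_projective (R : comPzRingType) :
  syzygy_closed (@Gorenstein_projective R).
Proof.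
move=> M [P [d [complete_d /is_image_iso imM]]].
have closed_d := syzygy_closed_images complete_d.
have [ext [N [imN MN]] [L [imL LM]]] := closed_d M (ex_intro _ 0 imM).
split=> //.
  exists N; split=> //; exact: Gorenstein_projective_of_closed closed_d imN.
by exists L; split=> //; exact: Gorenstein_projective_of_closed closed_d imL.
Qed.

Lemma Gorenstein_projective_projective (R : comPzRingType) (P : lmodType R) :
  projective P -> Gorenstein_projective P.
Proof.
apply: Gorenstein_projective_of_closed => {}P projP.
have [Z Z0] := exists_zero_module R.
split; first by move=> Q _; exact: Ext1_vanish_projective.
  exists Z; split; first exact: projective_zero.
  by exists P, idfun, \0; split=> //; exact: short_exact_id0.
exists Z; split; first exact: projective_zero.
by exists P, \0, idfun; split=> //; exact: short_exact_id.
Qed.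

(** The horseshoe lemma on the injective side: the map A -> P extends to D
because Ext^1(B, P) = 0, so D embeds in P + Q, and the nine lemma describes the
cokernel. *)
Lemma embeds_with_cokernel_extension (R : comPzRingType)
    (A D B A' B' : lmodType R) (i : {linear A -> D}) (p : {linear D -> B}) :
  short_exact i p -> (forall Q, projective Q -> Ext1_vanish B Q) ->
  embeds_with_cokernel A A' -> embeds_with_cokernel B B' ->
  exists (D' : lmodType R) (i' : {linear A' -> D'}) (p' : {linear D' -> B'}),
    embeds_with_cokernel D D' /\ short_exact i' p'.
Proof.
move=> sp extB [P [a [a1 [projP sa]]]] [Q [b [b1 [projQ sb]]]].
have [u uE] := extB P projP _ _ _ _ sp a.
have [v vE] := pairing u (b \o p).
have [j [q [sq jE qE]]] := split_short_exact P Q.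
have vi x : v (i x) = j (a x).
  by rewrite vE jE uE /= (short_exact_comp0 _ sp) linear0.
have bp y : b (p y) = q (v y) by rewrite qE vE.
have inj_v : injective v.
  have [[inj_a _ _] [inj_b _ _]] := (sa, sb).
  exact: injective_middle vi bp _ _.
have [D' [v1 [exact_v surj_v1]]] := exists_cokernel v.
have sv : short_exact v v1 by [].
have [i' [p' sp']] := nine_cokernels sp sq sa sv sb vi bp.
exists D', i', p'; split=> //; exists (P * Q)%type, v, v1; split=> //.
exact: projective_sum.
Qed.

(** The usual horseshoe lemma: Q -> B lifts to D because Q is projective. *)
Lemma covers_with_kernel_extension (R : comPzRingType)
    (A D B A' B' : lmodType R) (i : {linear A -> D}) (p : {linear D -> B}) :
  short_exact i p ->
  embeds_with_cokernel A' A -> embeds_with_cokernel B' B ->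
  exists (D' : lmodType R) (i' : {linear A' -> D'}) (p' : {linear D' -> B'}),
    embeds_with_cokernel D' D /\ short_exact i' p'.
Proof.
move=> sp [P [a [a1 [projP sa]]]] [Q [b [b1 [projQ sb]]]].
have [_ _ surj_p] := sp.
have [l lE] := projQ _ _ p b1 surj_p.
have [v vE] := copair (i \o a1) l.
have [j [q [sq jE qE]]] := split_short_exact P Q.
have vj x : v (j x) = i (a1 x) by rewrite jE vE linear0 addr0.
have bq y : b1 (q y) = p (v y).
  case: y => x y; rewrite qE vE linearD /= lE.
  by rewrite (short_exact_comp0 _ sp) add0r.
have surj_v : surjective v.
  have [[_ _ surj_a1] [_ _ surj_b1]] := (sa, sb).
  exact: surjective_middle vj bq _ _.
have [D' [v' [inj_v' exact_v]]] := exists_kernel v.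
have sv : short_exact v' v by [].
have [i' [p' sp']] := nine_kernels sq sp sa sv sb vj bq.
exists D', i', p'; split=> //; exists (P * Q)%type, v', v; split=> //.
exact: projective_sum.
Qed.

(** Both horseshoe lemmas show that the class of extensions of Gorenstein
projectives by Gorenstein projectives is closed under syzygies and
cosyzygies. *)
Lemma Gorenstein_projective_extension (R : comPzRingType) (A D B : lmodType R)
    (i : {linear A -> D}) (p : {linear D -> B}) :
  short_exact i p -> Gorenstein_projective A -> Gorenstein_projective B ->
  Gorenstein_projective D.
Proof.
move=> sp GA GB.
pose X (E : lmodType R) := exists (A B : lmodType R) (i : {linear A -> E})
  (p : {linear E -> B}),
  [/\ Gorenstein_projective A, Gorenstein_projective B & short_exact i p].
apply: (@Gorenstein_projective_of_closed R X); last by exists A, B, i, p.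
move=> {A B i p sp GA GB} E [A [B [i [p [GA GB sp]]]]].
have clG := @syzygy_closed_Gorenstein_projective R.
have [extA [A1 [GA1 AA1]] [A2 [GA2 A2A]]] := clG A GA.
have [extB [B1 [GB1 BB1]] [B2 [GB2 B2B]]] := clG B GB.
split.
- by move=> Q projQ; apply: (Ext1_vanish_extension sp); [exact: extA|exact: extB].
- have [E' [i' [p' [EE' sp']]]] := embeds_with_cokernel_extension sp extB AA1 BB1.
  by exists E'; split=> //; exists A1, B1, i', p'.
- have [E' [i' [p' [EE' sp']]]] := covers_with_kernel_extension sp A2A B2B.
  by exists E'; split=> //; exists A2, B2, i', p'.
Qed.

Lemma strongly_Gorenstein_projective_short_exact (R : comPzRingType)
    (M : lmodType R) :
  strongly_Gorenstein_projective M -> embeds_with_cokernel M M.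
Proof.
move=> [P [f [[projP exact_f _] /is_image_iso[b [a [surj_b inj_a fE]]]]]].
exists P, a, b; split; first exact: (projP 0).
exact: (short_exact_images (exact_f 0) surj_b inj_a fE surj_b inj_a).
Qed.

Lemma strongly_Gorenstein_projective_of_short_exact (R : comPzRingType)
    (M : lmodType R) :
  (forall Q, projective Q -> Ext1_vanish M Q) -> embeds_with_cokernel M M ->
  strongly_Gorenstein_projective M.
Proof.
move=> extM [P [a [b [projP sab]]]]; exists P, (a \o b); split.
  exact: (@complete_resolution_splice R (fun=> M) (fun=> P) (fun=> a) (fun=> b)).
by apply/is_image_iso; case: sab => inj_a _ surj_b; exact: is_image_comp.
Qed.

(** * Resolutions of length one *)

Lemma dim_le_least (p : nat -> Prop) n :
  dim_le (least p) n <-> exists2 m, (m <= n)%N & p m.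
Proof.
rewrite /least; case: pselect => [ex_p|no_p] /=; last first.
  by split=> // -[m _ pm]; case: no_p; exists m; apply/asboolP.
case: ex_minnP => m /asboolP pm min_m; split=> [mn|[k kn pk]]; first by exists m.
by apply: leq_trans kn; apply: min_m; apply/asboolP.
Qed.

(** Resolutions of length 0 are included, with G1 = 0; this is why X has to
contain the zero modules. *)
Lemma short_exact_of_resolution (R : comPzRingType) (X : lmodType R -> Prop)
    (M : lmodType R) :
  (forall Z : lmodType R, (forall z : Z, z = 0) -> X Z) ->
  dim_le (least (has_resolution X M)) 1 ->
  exists (G1 G0 : lmodType R) (i : {linear G1 -> G0}) (p : {linear G0 -> M}),
    [/\ X G1, X G0 & short_exact i p].
Proof.
move=> X0 /dim_le_least[n n1 [G [d [e [XG G0 exact_d exact_e surj_e]]]]].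
exists (G 1%N), (G 0%N), (d 0%N), e; split; last 1 first.
- split=> //; apply: linear_injective => x /exact_d[y <-].
  by rewrite (G0 2 _ y) ?linear0.
- case: n n1 XG G0 => [|[|n]] // _ XG G0; last exact: XG.
  by apply: X0; exact: G0.
- exact: XG.
Qed.

Lemma resolution_of_short_exact (R : comPzRingType) (X : lmodType R -> Prop)
    (G1 G0 M : lmodType R) (i : {linear G1 -> G0}) (p : {linear G0 -> M}) :
  X G1 -> X G0 -> short_exact i p -> dim_le (least (has_resolution X M)) 1.
Proof.
move=> XG1 XG0 sp; apply/dim_le_least; exists 1%N => //.
have [Z Z0] := exists_zero_module R; have [inj_i exact_i surj_p] := sp.
pose G n := match n with 0 => G0 | 1 => G1 | _ => Z end.
pose d n : {linear G n.+1 -> G n} :=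
  match n with 0 => i | _ => \0 end.
exists G, d, p; split=> //.
- by case=> [|[|n]].
- by case=> [|[|n]].
- case=> [|n] y /=; last by split=> // _; exists 0; rewrite (Z0 y).
  split=> [/(short_exact_map0 sp) ->|[x <-]]; last exact: linear0.
  by exists 0.
Qed.

(** * Self-extensions of modules of Gorenstein projective dimension one *)

(** D is the pushout of G1 -> G0 along G1 -> P.  Its two exact sequences
0 -> G0 -> D -> G' -> 0 and 0 -> P -> D -> M -> 0 both come from the nine lemma,
for the two ways of seeing G0 + P as an extension, mapped into by
0 -> 0 -> G1 -> G1 -> 0. *)
Lemma projective_kernel_resolution (R : comPzRingType) (G1 G0 M : lmodType R)
    (i : {linear G1 -> G0}) (p : {linear G0 -> M}) :
  short_exact i p -> Gorenstein_projective G1 -> Gorenstein_projective G0 ->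
  exists (P D : lmodType R) (j : {linear P -> D}) (q : {linear D -> M}),
    [/\ projective P, Gorenstein_projective D & short_exact j q].
Proof.
move=> sp GG1 GG0.
have [_ [G' [GG' [P [j [q [projP sj]]]]]] _] :=
  syzygy_closed_Gorenstein_projective GG1.
have [inj_i _ _] := sp; have [Z Z0] := exists_zero_module R.
have [v vE] := pairing i j.
have inj_v : injective v by move=> x y; rewrite !vE => -[/inj_i].
have [D [w [exact_v surj_w]]] := exists_cokernel v.
have sv : short_exact v w by [].
have sG1 := short_exact_id G1 Z0.
have [a [b [sab aE bE]]] := split_short_exact G0 P.
have [a' [b' [sab' aE' bE']]] := split_short_exact_sym G0 P.
have [||i2 [p2 sp2]] := nine_cokernels sG1 sab (short_exact_id G0 Z0) sv sj.
- by move=> x /=; rewrite !linear0.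
- by move=> x /=; rewrite vE bE.
have [||i3 [p3 sp3]] := nine_cokernels sG1 sab' (short_exact_id P Z0) sv sp.
- by move=> x /=; rewrite !linear0.
- by move=> x /=; rewrite vE bE'.
exists P, D, i3, p3; split=> //.
exact: Gorenstein_projective_extension sp2 GG0 GG'.
Qed.

(** The embedding P -> G lifts along F -> G, hence extends to a map from
0 -> P -> P + P -> P -> 0 to 0 -> G -> F -> G -> 0; the cokernels of its
components form the required sequence. *)
Lemma self_extension_of_projective_kernel (R : comPzRingType) (P G M : lmodType R)
    (j : {linear P -> G}) (q : {linear G -> M}) :
  short_exact j q -> projective P -> embeds_with_cokernel G G ->
  exists (Q : lmodType R) (f : {linear M -> Q}) (g : {linear Q -> M}),
    short_exact f g /\ dim_le (pd Q) 1.
Proof.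
move=> sj projP [F [a [b [projF sab]]]].
have [_ _ surj_b] := sab; have [inj_j _ _] := sj.
have [l lE] := projP _ _ b j surj_b.
have [v vE] := copair (a \o j) l.
have [i [p [sp iE pE]]] := split_short_exact P P.
have vi x : v (i x) = a (j x) by rewrite iE vE linear0 addr0.
have jp y : j (p y) = b (v y).
  case: y => x y; rewrite pE vE linearD /= lE.
  by rewrite (short_exact_comp0 _ sab) add0r.
have inj_v : injective v by exact: injective_middle vi jp _ _.
have [Q [w [exact_v surj_w]]] := exists_cokernel v.
have sv : short_exact v w by [].
have [f [g sfg]] := nine_cokernels sp sab sj sv sj vi jp.
exists Q, f, g; split=> //.
by apply: (resolution_of_short_exact _ _ sv) => //; exact: projective_sum.
Qed.

Theorem theorem2p1 (R : comPzRingType) :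
  (forall M : lmodType R,
     Gorenstein_projective M -> strongly_Gorenstein_projective M)
  <->
  (forall M : lmodType R, dim_le (Gpd M) 1 ->
     exists (Q : lmodType R) (f : {linear M -> Q}) (g : {linear Q -> M}),
       short_exact f g /\ dim_le (pd Q) 1).
Proof.
have GP0 (Z : lmodType R) : (forall z : Z, z = 0) -> Gorenstein_projective Z.
  by move=> /projective_zero; exact: Gorenstein_projective_projective.
split=> [GP_SGP M|self_ext M GM].
  case/(short_exact_of_resolution GP0)=> G1 [G0 [i [p [GG1 GG0 sp]]]].
  have [P [D [j [q [projP GD sj]]]]] := projective_kernel_resolution sp GG1 GG0.
  apply: (self_extension_of_projective_kernel sj projP).
  exact/strongly_Gorenstein_projective_short_exact/GP_SGP.
have [extM _ _] := syzygy_closed_Gorenstein_projective GM.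
have [|Q [f [g [sfg pdQ]]]] := self_ext M.
  (* The sequence 0 -> 0 -> M -> M -> 0 shows that Gpd M <= 1. *)
  have [Z Z0] := exists_zero_module R.
  exact: resolution_of_short_exact (GP0 Z Z0) GM (short_exact_id M Z0).
have [P1 [P0 [i [p [projP1 projP0 sp]]]]] :=
  short_exact_of_resolution (@projective_zero R) pdQ.
apply: strongly_Gorenstein_projective_of_short_exact => //.
exists Q, f, g; split=> //; apply: (projective_of_Ext1_vanish sp) => //.
by apply: (Ext1_vanish_extension sfg); exact: extM.
Qed.
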